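(* Let $\lambda_n=-in(n^4+n^2-1)$ for $n\in\mathbb{Z}^*=\mathbb{Z}\setminus\{0\}$. There exist a constant $T_1>0$ and a sequence $(\Theta_m)_{m\in\mathbb{Z}^*}$ biorthogonal to the family $(e^{-\lambda_nt})_{n\in\mathbb{Z}^*}$ in $L^2(-\frac{T_1}2,\frac{T_1}2)$. Moreover, for all $m\in\mathbb{Z}^*$, $$\|\Theta_m\|_{L^2(-\frac{T_1}2,\frac{T_1}2)}\le C\exp(bm^6),$$ where $C$ and $b$ are positive constants (independent of $m$).
   Context: The numbers $\lambda_n$ are the nonzero eigenvalues of $Au=\partial_x^5u-\partial_x^3u-\partial_xu$ with periodic boundary conditions on $(0,2\pi)$. A sequence $(\Theta_m)$ in $L^2(I)$ (complex-valued functions) is biorthogonal to a family $(e_n)\subset L^2(I)$ with the same index set if $\int_I\Theta_m(t)\overline{e_n(t)}\,dt=\delta_{mn}$ (Kronecker symbol) for all $m,n$; for $e_n(t)=e^{-\lambda_nt}$ this reads $\int_I\Theta_m(t)e^{\lambda_nt}\,dt=\delta_{mn}$. *)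

(* Defs.v *)
From mathcomp Require Export all_boot all_order all_algebra.
From mathcomp Require Export all_classical all_reals all_analysis.
From mathcomp Require Export complex.

Set Implicit Arguments.
Unset Strict Implicit.
Unset Printing Implicit Defensive.

Export Order.TTheory GRing.Theory Num.Theory numFieldNormedType.Exports.

Open Scope classical_set_scope.
Open Scope ring_scope.
Open Scope complex_scope.

Definition cexp (R : realType) (z : R[i]) : R[i] :=
  (expR (complex.Re z))%:C * (cos (complex.Im z) +i* sin (complex.Im z)).

(* The libraries put no measurable structure on R[i], hence the componentwise
   measurability and integral. Rintegral is a total function, with
   a default value when the integral is infinite; cintegral is only applied to
   products of two elements of L^2(D), which are integrable. *)
Definition cmeasurable_fun (R : realType) (D : set R) (f : R -> R[i]) : Prop :=
  measurable_fun D (fun t => complex.Re (f t)) /\ measurable_fun D (fun t => complex.Im (f t)).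

Definition cintegral (R : realType) (D : set R) (f : R -> R[i]) : R[i] :=
  Rintegral lebesgue_measure D (fun t => complex.Re (f t)) +i*
  Rintegral lebesgue_measure D (fun t => complex.Im (f t)).

(* Elements of L^2(D) are represented by functions on R, of which only the
   restriction to D matters. normc is the modulus with values in R
   (the norm `|z| of R[i] has values in R[i]). *)
Definition L2norm (R : realType) (D : set R) (f : R -> R[i]) : \bar R :=
  'N[lebesgue_measure]_2%:E
    [(fun t => (Normc.normc (f t))%:E) \_ D]%E.

Definition in_L2 (R : realType) (D : set R) (f : R -> R[i]) : Prop :=
  cmeasurable_fun D f /\ (L2norm D f < +oo)%E.

Definition biorthogonal (R : realType) (J : eqType) (D : set R)
    (Theta e : J -> R -> R[i]) : Prop :=
  [/\ forall m, in_L2 D (Theta m),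
      forall n, in_L2 D (e n) &
      forall m n,
        cintegral D (fun t => Theta m t * conjc (e n t)) = (m == n)%:R].

Definition nzint : eqType := {n : int | n != 0}.

Definition lambda (R : realType) (n : nzint) : R[i] :=
  let x : R[i] := (val n)%:~R in
  - 'i%C * x * (x ^+ 4 + x ^+ 2 - 1).

(* Main.v *)
Require Import Defs.
From mathcomp Require Import measurable_realfun ring lra zify.

Set Implicit Arguments.
Unset Strict Implicit.
Unset Printing Implicit Defensive.

(** The eigenvalues are purely imaginary and sit on the integer lattice:
    [- lambda_n = i * freq n] with [freq n = n (n^4 + n^2 - 1)] an integer.
    Hence the functions [exp (- lambda_n t)] all belong to the classical Fourier
    system [exp (i k t)], [k] an integer, which is orthogonal on [(-pi, pi)].
    Since [freq] is injective ([freq_inj]), distinct indices select distinct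
    members of that system, so with [T1 = 2 pi] the family is orthogonal and its
    own multiples [Theta_m (t) = exp (- lambda_m t) / (2 pi)] are biorthogonal
    to it. They have constant modulus, hence a norm independent of [m], and this
    norm serves as [C]: the growth factor [exp (b m^6)] is at least 1. *)

Definition freq (n : int) : int := n * (n ^+ 4 + n ^+ 2 - 1).

(** [freq m - freq n] is [m - n] times a cofactor [q + (r - 1)], where [q] and
    [r] are the positive definite forms [(m^5 - n^5) / (m - n)] and
    [m^2 + m n + n^2]. If the cofactor vanishes then [r <= 1], which leaves only
    [m] and [n] in [{-1, 0, 1}], where [freq] is the identity. *)
Lemma freq_inj : injective freq.
Proof.
move=> m n /eqP; rewrite -subr_eq0 /freq.
have -> : m * (m ^+ 4 + m ^+ 2 - 1) - n * (n ^+ 4 + n ^+ 2 - 1) =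
  (m - n) * (m ^+ 4 + m ^+ 3 * n + m ^+ 2 * n ^+ 2 + m * n ^+ 3 + n ^+ 4
    + (m ^+ 2 + m * n + n ^+ 2 - 1)) by ring.
rewrite mulf_eq0 subr_eq0 => /orP[/eqP //|/eqP h].
(* 4 q = (2 m^2 + m n)^2 + (2 n^2 + m n)^2 + 2 (m n)^2 *)
have q0 : 0 <= m ^+ 4 + m ^+ 3 * n + m ^+ 2 * n ^+ 2 + m * n ^+ 3 + n ^+ 4.
  have := sqr_ge0 (2 * m ^+ 2 + m * n); have := sqr_ge0 (2 * n ^+ 2 + m * n).
  have := sqr_ge0 (m * n); lra.
(* 4 r = (2 n + m)^2 + 3 m^2, and symmetrically *)
have hm : 3 * m ^+ 2 <= 4 by have := sqr_ge0 (2 * n + m); lra.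
have hn : 3 * n ^+ 2 <= 4 by have := sqr_ge0 (2 * m + n); lra.
have {hm} : m = -1 \/ m = 0 \/ m = 1 by clear -hm; rewrite expr2 in hm; nia.
have {hn} : n = -1 \/ n = 0 \/ n = 1 by clear -hn; rewrite expr2 in hn; nia.
by case=> [?|[?|?]] [?|[?|?]]; subst.
Qed.

Definition fourier (R : realType) (k : int) (t : R) : R[i] :=
  cos (k%:~R * t) +i* sin (k%:~R * t).

Lemma fourier_mul_conj (R : realType) (k l : int) (t : R) :
  fourier k t * conjc (fourier l t) = fourier (k - l) t.
Proof.
rewrite /fourier /= intrB mulrBl cosB sinB; apply/eqP; rewrite eq_complex /=.
by apply/andP; split; apply/eqP; ring.
Qed.

Lemma normc_fourier (R : realType) (k : int) (t : R) :
  Normc.normc (fourier k t) = 1.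
Proof. by rewrite /fourier /Normc.normc cos2Dsin2 sqrtr1. Qed.

Lemma cexp_lambda (R : realType) (n : nzint) (t : R) :
  cexp (- lambda R n * t%:C) = fourier (freq (val n)) t.
Proof.
have freqE : (freq (val n))%:~R =
    (val n)%:~R * ((val n)%:~R ^+ 4 + (val n)%:~R ^+ 2 - 1) :> R[i].
  by rewrite /freq rmorphM rmorphB rmorphD /= !rmorphXn /= rmorph1.
have -> : - lambda R n * t%:C = 0 +i* ((freq (val n))%:~R * t).
  have -> : - lambda R n = 'i%C * ((freq (val n))%:~R)%:C.
    by rewrite /lambda (rmorph_int (real_complex R)) freqE; ring.
  by apply/eqP; rewrite eq_complex /=; apply/andP; split; apply/eqP; ring.
by rewrite /cexp /fourier /= expR0 mul1r.
Qed.

Lemma sin_int_pi (R : realType) (k : int) : sin (k%:~R * pi) = 0 :> R.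
Proof.
have sn n : sin (n%:R * pi) = 0 :> R.
  by rewrite -[_ * _]add0r mulr_natl (alternatingn (@sinDpi R)) sin0 mulr0.
case: k => n; first exact: sn.
by rewrite NegzE rmorphN /= mulNr sinN sn oppr0.
Qed.

(** The form of the fundamental theorem of calculus that yields orthogonality:
    on a full number of periods an antiderivative returns to its initial
    value. *)
Lemma Rintegral_derive_eq (R : realType) (a b : R) (F f : R -> R) :
  a < b -> (forall x, is_derive x (1 : R) F (f x)) -> continuous f ->
  F a = F b -> \int[lebesgue_measure]_(t in `]a, b[) f t = 0.
Proof.
move=> ab dF cf Fab.
have cF : continuous F.
  by move=> x; apply/differentiable_continuous/derivable1_diffP; case: (dF x).
rewrite /Rintegral -(@integral_itv_bndoo _ a b _ true false); last first.
  apply/measurable_EFinP; apply: measurable_funTS.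
  exact: continuous_measurable_fun.
rewrite (@continuous_FTC2 _ f F) //.
- by rewrite Fab subee.
- exact: continuous_subspaceT.
- split.
  + by move=> x _; case: (dF x).
  + by apply: cvg_at_right_filter; exact: cF.
  + by apply: cvg_at_left_filter; exact: cF.
- by move=> x _; rewrite derive1E; case: (dF x).
Qed.

Lemma cintegral_fourier (R : realType) (c : R) (k : int) :
  cintegral (`](- pi), pi[)%classic (fun t => c%:C * fourier k t) =
    (c * (pi *+ 2 *+ (k == 0)))%:C.
Proof.
have pip : - pi < pi :> R by rewrite gt0_cp // pi_gt0.
have -> : (fun t => c%:C * fourier k t) =
    (fun t => (c * cos (k%:~R * t)) +i* (c * sin (k%:~R * t))).
  apply/funext => t; apply/eqP; rewrite eq_complex /=.
  by rewrite !mul0r subr0 addr0 !eqxx.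
rewrite /cintegral /=; have [->|k0] := eqVneq k 0.
  under eq_Rintegral do rewrite mul0r cos0 mulr1.
  under [in X in _ +i* X]eq_Rintegral do rewrite mul0r sin0 mulr0.
  rewrite !Rintegral_cst//= lebesgue_measure_itv /= lte_fin pip /=.
  by rewrite mul0r opprK.
have kR0 : k%:~R != 0 :> R by rewrite intr_eq0.
have cdil (g : R -> R) : continuous g ->
    continuous (fun t : R => c * g (k%:~R * t)).
  move=> cg x; apply: cvgM; first exact: cvg_cst.
  by apply: continuous_comp; [exact: mulrl_continuous | exact: cg].
rewrite mulr0n mulr0; congr (_ +i* _).
- apply: (@Rintegral_derive_eq _ _ _
    (fun t => c / k%:~R * sin (k%:~R * t))) => //.
  + by move=> x; apply: is_derive_eq; rewrite /GRing.scale /=; field; exact: kR0.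
  + exact/cdil/continuous_cos.
  + by rewrite mulrN sinN sin_int_pi oppr0.
- apply: (@Rintegral_derive_eq _ _ _
    (fun t => - (c / k%:~R) * cos (k%:~R * t))) => //.
  + by move=> x; apply: is_derive_eq; rewrite /GRing.scale /=; field; exact: kR0.
  + exact/cdil/continuous_sin.
  + by rewrite mulrN cosN.
Qed.

Lemma L2norm_cst_normc (R : realType) (D : set R) (c : R) (f : R -> R[i]) :
  measurable D -> (forall t, Normc.normc (f t) = c) ->
  L2norm D f = (((c ^+ 2)%:E * lebesgue_measure D) `^ 2^-1)%E.
Proof.
move=> mD fc; rewrite /L2norm unlock; congr (_ `^ _)%E.
rewrite -integral_cst // [RHS]integral_mkcond; apply: eq_integral => t _ /=.
rewrite !patchE; case: ifP => _ /=.
  by rewrite fc powR_mulrn // real_normK // num_real.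
by rewrite normr0 powR0.
Qed.

Lemma L2norm_fourier (R : realType) (D : set R) (c : R) (k : int) :
  measurable D ->
  L2norm D (fun t => c%:C * fourier k t) =
    (((c ^+ 2)%:E * lebesgue_measure D) `^ 2^-1)%E.
Proof.
move=> mD; rewrite (@L2norm_cst_normc _ _ `|c|) ?real_normK ?num_real // => t.
rewrite Normc.normcM normc_fourier mulr1 /Normc.normc /= expr0n addr0.
exact: sqrtr_sqr.
Qed.

Lemma in_L2_fourier (R : realType) (D : set R) (c : R) (k : int) :
  measurable D -> (lebesgue_measure D < +oo)%E ->
  in_L2 D (fun t => c%:C * fourier k t).
Proof.
move=> mD Dfin; split; last first.
  by rewrite L2norm_fourier // poweR_lty // lte_mul_pinfty // lee_fin sqr_ge0.
have mlin : measurable_fun setT (fun t : R => k%:~R * t).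
  by apply: continuous_measurable_fun => x; exact: mulrl_continuous.
have mcos : measurable_fun setT (fun t : R => cos (k%:~R * t)).
  apply: measurableT_comp mlin; apply: continuous_measurable_fun.
  exact: continuous_cos.
have msin : measurable_fun setT (fun t : R => sin (k%:~R * t)).
  apply: measurableT_comp mlin; apply: continuous_measurable_fun.
  exact: continuous_sin.
split; apply: measurable_funTS => /=.
- by apply: measurable_funB; apply: measurable_funM.
- by apply: measurable_funD; apply: measurable_funM.
Qed.

Theorem theorem2p3 (R : realType) :
  exists T1 : R, 0 < T1 /\
  let I : set R := (`](- (T1 / 2)), (T1 / 2)[)%classic in
  exists Theta : nzint -> R -> R[i],
    biorthogonal I Theta (fun n t => cexp (- lambda R n * t%:C)) /\
    exists C b : R, [/\ 0 < C, 0 < b &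
      forall m : nzint,
        (L2norm I (Theta m) <= (C * expR (b * (val m)%:~R ^+ 6))%:E)%E].
Proof.
have pi2_gt0 : 0 < pi *+ 2 :> R by rewrite mulrn_wgt0 // pi_gt0.
exists (pi *+ 2); split=> //=.
have -> : pi *+ 2 / 2 = pi :> R by rewrite -(mulr_natr pi 2) mulfK.
set I : set R := (`](- pi), pi[)%classic.
have mI : measurable I by exact: measurable_itv.
have IE : lebesgue_measure I = (pi *+ 2)%:E.
  by rewrite lebesgue_measure_itv /= lte_fin gt0_cp ?pi_gt0 // -EFinB opprK.
have expE : (fun n t => cexp (- lambda R n * t%:C)) =
    (fun (n : nzint) t => 1%:C * fourier (freq (val n)) t).
  by apply/funext => n; apply/funext => t; rewrite cexp_lambda mul1r.
exists (fun m t => ((pi *+ 2)^-1)%:C * fourier (freq (val m)) t); split.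
  rewrite expE; split=> [m|n|m n].
  - by apply: in_L2_fourier; rewrite // IE ltry.
  - by apply: in_L2_fourier; rewrite // IE ltry.
  - under eq_fun do rewrite mul1r -mulrA fourier_mul_conj.
    rewrite cintegral_fourier subr_eq0 (inj_eq freq_inj) (inj_eq val_inj).
    by case: (m == n); rewrite ?mulr0 // mulVf // gt_eqF.
(* the norm shared by all the Theta m *)
pose C : R := ((pi *+ 2)^-1 ^+ 2 * (pi *+ 2)) `^ 2^-1.
have C_gt0 : 0 < C by rewrite powR_gt0 // mulr_gt0 // exprn_gt0 // invr_gt0.
exists C, 1; split=> // m.
rewrite L2norm_fourier // IE -EFinM poweR_EFin lee_fin -/C.
rewrite ler_peMr ?(ltW C_gt0) // mul1r -expR0 ler_expR.
by rewrite exprn_even_ge0.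
Qed.
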